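(* Let $m\ge 2$, $0<\rho<1$, and let $S_j(x)=\rho x+d_j$, $j=0,\dots,m$, where $0=d_0<d_1<\dots<d_m=1-\rho$ and $d_j-d_{j-1}\le\rho$ for all $j=1,\dots,m$. Let $p_0,\dots,p_m>0$ with $\sum_{j=0}^m p_j=1$, and let $\mu$ be the self-similar measure associated with $(S_j,p_j)$. Suppose the IFS has the strict overlap property, i.e. $S_j(1)>S_{j+1}(0)$ for each $j=0,\dots,m-1$. Suppose $p_0=p_m<p_j$ for all $j\neq 0,m$. In addition, assume that $S_{m-1}(1)>S_m(S_1(0))$ and $S_1(0)<S_0(S_{m-1}(1))$. Then $$\sup_{x\in[0,1],\,x\neq 0,1}\overline{\dim}_{\mathrm{loc}}\,\mu(x)<\dim_{\mathrm{loc}}\mu(0),$$ and thus $\dim_{\mathrm{loc}}\mu(0)=\dim_{\mathrm{loc}}\mu(1)$ is an isolated point in the set $\{\dim_{\mathrm{loc}}\mu(x):x\in\operatorname{supp}\mu\}$ of local dimensions of $\mu$.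
   Context: The self-similar measure associated with $(S_j,p_j)$ is the unique Borel probability measure $\mu$ satisfying $\mu=\sum_{j=0}^m p_j\cdot\mu\circ S_j^{-1}$. Under the stated assumptions its support is $[0,1]$. For $x\in\operatorname{supp}\mu$, the local dimension is $\dim_{\mathrm{loc}}\mu(x)=\lim_{\epsilon\to0^+}\frac{\log\mu([x-\epsilon,x+\epsilon])}{\log\epsilon}$ when the limit exists, and the upper local dimension is $\overline{\dim}_{\mathrm{loc}}\,\mu(x)=\limsup_{\epsilon\to0^+}\frac{\log\mu([x-\epsilon,x+\epsilon])}{\log\epsilon}$. The set of local dimensions consists of the values $\dim_{\mathrm{loc}}\mu(x)$ over those $x\in\operatorname{supp}\mu$ where the limit exists; the limits at $x=0$ and $x=1$ exist as part of the assertion. *)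

(* Defs.v *)
From HB Require Import structures.
From mathcomp Require Import all_boot all_order all_algebra.
From mathcomp Require Import all_classical all_reals all_analysis.
Import Order.TTheory GRing.Theory Num.Theory.
Import numFieldNormedType.Exports.

Set Implicit Arguments.
Unset Strict Implicit.
Unset Printing Implicit Defensive.

Local Open Scope classical_set_scope.
Local Open Scope ring_scope.

                                                                         
                                     
Definition ifs_map (R : realType) (rho : R) (d : nat -> R) (j : nat) (x : R) : R :=
  rho * x + d j.

Definition strict_overlap (R : realType) (m : nat) (rho : R) (d : nat -> R) : Prop :=
  forall j, (j < m)%N -> ifs_map rho d j.+1 0 < ifs_map rho d j 1.

Definition self_similar_measure (R : realType) (m : nat) (rho : R)
    (d p : nat -> R) (mu : probability (measurableTypeR R) R) : Prop :=
  forall A : set (measurableTypeR R), measurable A ->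
    mu A = (\sum_(j < m.+1) (p j)%:E * mu (ifs_map rho d j @^-1` A))%E.

Definition measure_support (R : realType)
    (mu : probability (measurableTypeR R) R) : set R :=
  [set x | forall e : R, 0 < e -> (0 < mu (ball x e))%E].

                                                                         
                
Definition log_ratio (R : realType) (mu : probability (measurableTypeR R) R)
    (x e : R) : \bar R :=
  (lne (mu [set` `[x - e, x + e]%R]) / (ln e)%:E)%E.

Definition has_local_dim (R : realType) (mu : probability (measurableTypeR R) R)
    (x : R) : Prop :=
  cvg (log_ratio mu x e @[e --> 0^'+]).

Definition local_dim (R : realType) (mu : probability (measurableTypeR R) R)
    (x : R) : \bar R :=
  lim (log_ratio mu x e @[e --> 0^'+]).

Definition upper_local_dim (R : realType)
    (mu : probability (measurableTypeR R) R) (x : R) : \bar R :=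
  limf_esup (log_ratio mu x) 0^'+.

Definition local_dims (R : realType) (mu : probability (measurableTypeR R) R) :
    set (\bar R) :=
  [set local_dim mu x | x in [set x | measure_support mu x /\ has_local_dim mu x]].

(* Main.v *)
(* Let D = ln p_0 / ln rho. Near the fixed points 0 and 1 only one map of the
   system contributes, so mu([-e, e]) and mu([1-e, 1+e]) are comparable to e^D
   and the local dimension there is D.

   For an interior point y, mu(B(y, e)) >= p_j mu(B(S_j^-1 y, e / rho)), and one
   chooses the digit j step by step. A digit 0 < j < m has p_j >= q > p_0, and by
   strict overlap it can be used, landing in [delta, 1 - delta], unless y < a or
   y > b, where a = S_1(delta) and b = S_{m-1}(1 - delta). The two extra hypotheses
   say that (for small delta) y < a implies y / rho <= b, and y > b implies
   S_m^-1 y >= a. Hence the loss of a run of digits 0 (or m) is controlled by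
   y^s (or (1-y)^s), and mu(B(y, e)) >= c(y) e^t with t = D - s, where s > 0
   depends only on p_0, q, delta and rho. *)

Require Import Defs.
From HB Require Import structures.
From mathcomp Require Import all_boot all_order all_algebra.
From mathcomp Require Import all_classical all_reals all_analysis.
From mathcomp Require Import ring lra zify.
Import Order.TTheory GRing.Theory Num.Theory.
Import numFieldNormedType.Exports.

Local Open Scope classical_set_scope.
Local Open Scope ring_scope.

Set Implicit Arguments.
Unset Strict Implicit.

(** * Induction on scales and logarithms of power laws *)

Section real_facts.
Variable R : realType.
Implicit Types (r c x e t : R).

(** Each zoom replaces [e] by [e / r]; as [r ^+ n] tends to 0, finitely many zooms bring any
    positive scale up to at least 1. *)
Lemma scale_ind (P : R -> Prop) r : 0 < r < 1 ->
  (forall e, 1 <= e -> P e) ->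
  (forall e, 0 < e < 1 -> P (e / r) -> P e) ->
  forall e, 0 < e -> P e.
Proof.
move=> /andP[r0 r1] P1 PS.
have key n : forall e, 0 < e -> r ^+ n <= e -> P e.
  elim: n => [e _|n IH e e0 ne]; first by rewrite expr0; exact: P1.
  have [e1|e1] := leP 1 e; first exact: P1.
  apply: PS; first by rewrite e0.
  apply: IH; first by rewrite divr_gt0.
  by rewrite ler_pdivlMr// -exprSr.
move=> e e0.
have : r ^+ n @[n --> \oo] --> (0 : R).
  by apply: cvg_expr; rewrite gtr0_norm.
move/cvgrPdist_lt => /(_ e e0)[N _ /(_ N (leqnn N))] /=.
rewrite sub0r normrN gtr0_norm ?exprn_gt0// => /ltW; exact: key.
Qed.

Lemma finite_pos_lower_bound (n : nat) (f : nat -> R) :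
  (forall i, (i < n)%N -> 0 < f i) ->
  exists2 c, 0 < c & forall i, (i < n)%N -> c <= f i.
Proof.
elim: n => [_|n IH f0]; first by exists 1.
have [|c c0 cf] := IH; first by move=> i /ltnW; exact: f0.
exists (Num.min c (f n)); first by rewrite lt_min c0 f0.
move=> i; rewrite ltnS leq_eqVlt ge_min => /orP[/eqP ->|/cf ->//].
by rewrite lexx orbT.
Qed.

Lemma powR_log r c : 0 < r < 1 -> 0 < c -> r `^ (ln c / ln r) = c.
Proof.
move=> /andP[r0 r1] c0; have lr : ln r < 0 by apply: ln_lt0; rewrite r0.
by rewrite /powR gt_eqF// divfK ?lnK// lt_eqF.
Qed.

(** With [c = ln C], the expression is ln(C e^t) / ln e, so multiplicative constants do not affect
    local dimensions. *)
Lemma cvg_add_div_ln t c : t + c / ln e @[e --> 0^'+] --> t.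
Proof.
rewrite -[X in _ --> X]addr0; apply: cvgD; first exact: cvg_cst.
rewrite -[X in _ --> X](mulr0 c); apply: cvgMl_tmp.
apply/(ltr0_cvgV0 _).2; last exact: lnNy.
near=> e; apply: ln_lt0; apply/andP; split; near: e; first exact: nbhs_right_gt.
exact: nbhs_right_lt.
Unshelve. all: end_near. Qed.

End real_facts.

(** * From ball masses to local dimensions *)

Section ball_mass.
Variables (R : realType) (mu : probability (measurableTypeR R) R).
Implicit Types (x e t C : R).

Definition mass x e : R := fine (mu [set` `[x - e, x + e]%R]).

Lemma measure_itv_mass x e : mu [set` `[x - e, x + e]%R] = (mass x e)%:E.
Proof.
rewrite /mass fineK//; apply: fin_num_measure; exact: measurable_itv.
Qed.

Lemma mass_ge0 x e : 0 <= mass x e.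
Proof. by rewrite -lee_fin -measure_itv_mass. Qed.

Lemma mass_le1 x e : mass x e <= 1.
Proof.
rewrite -lee_fin -measure_itv_mass; apply: probability_le1; exact: measurable_itv.
Qed.

Lemma le_mass x e y e' : y - e' <= x - e -> x + e <= y + e' ->
  mass x e <= mass y e'.
Proof.
move=> h1 h2; rewrite -lee_fin -!measure_itv_mass.
apply: le_measure; rewrite ?inE; [exact: measurable_itv|exact: measurable_itv|].
move=> z /=; rewrite !in_itv /= => /andP[? ?]; apply/andP; split; lra.
Qed.

(** Since [ln e < 0], dividing by it reverses inequalities: lower bounds on mass become upper bounds
    on dimension. *)
Lemma log_ratio_le x e t C : 0 < e < 1 -> 0 < C -> C * e `^ t <= mass x e ->
  (log_ratio mu x e <= (t + ln C / ln e)%:E)%E.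
Proof.
move=> /andP[e0 e1] C0 Ce; have le0 : ln e < 0 by apply: ln_lt0; rewrite e0.
have Ce0 : 0 < C * e `^ t by rewrite mulr_gt0// powR_gt0.
rewrite /log_ratio measure_itv_mass lne_EFin ?(lt_le_trans Ce0)//.
rewrite inver lt_eqF// -EFinM lee_fin ler_ndivrMr// mulrDl divfK ?lt_eqF//.
by rewrite addrC -ln_powR -lnM ?posrE ?powR_gt0// ler_ln ?posrE ?(lt_le_trans Ce0).
Qed.

Lemma log_ratio_ge x e t C : 0 < e < 1 -> 0 < C ->
  0 < mass x e -> mass x e <= C * e `^ t ->
  ((t + ln C / ln e)%:E <= log_ratio mu x e)%E.
Proof.
move=> /andP[e0 e1] C0 m0 Ce; have le0 : ln e < 0 by apply: ln_lt0; rewrite e0.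
have Ce0 : 0 < C * e `^ t by rewrite mulr_gt0// powR_gt0.
rewrite /log_ratio measure_itv_mass lne_EFin//.
rewrite inver lt_eqF// -EFinM lee_fin ler_ndivlMr// mulrDl divfK ?lt_eqF//.
by rewrite addrC -ln_powR -lnM ?posrE ?powR_gt0// ler_ln ?posrE.
Qed.

Lemma near0_lt1 : \forall e \near (0 : R)^'+, 0 < e < 1.
Proof.
near=> e; apply/andP; split; near: e; first exact: nbhs_right_gt.
exact: nbhs_right_lt.
Unshelve. all: end_near. Qed.

Lemma near_log_ratio_le x t C eta : 0 < C -> 0 < eta ->
  (forall e, 0 < e < 1 -> C * e `^ t <= mass x e) ->
  \forall e \near 0^'+, (log_ratio mu x e <= (t + eta)%:E)%E.
Proof.
move=> C0 eta0 h.
have /cvgrPdist_le/(_ eta eta0) := @cvg_add_div_ln R t (ln C).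
apply: filterS2 near0_lt1 => e e01; rewrite ler_distl => /andP[? _].
apply: le_trans (log_ratio_le e01 C0 (h _ e01)) _; rewrite lee_fin; lra.
Qed.

Lemma upper_local_dim_le x t C : 0 < C ->
  (forall e, 0 < e < 1 -> C * e `^ t <= mass x e) ->
  (upper_local_dim mu x <= t%:E)%E.
Proof.
move=> C0 h; apply/lee_addgt0Pr => eta eta0.
(* [limf_esup] is an infimum, over the sets of the filter, of suprema; the set where the ratio is at
   most [t + eta] is the witness. *)
apply: ge_ereal_inf; exists (ereal_sup (log_ratio mu x @`
    [set e | (log_ratio mu x e <= (t + eta)%:E)%E])).
  eexists; last by []. exact: near_log_ratio_le h.
by apply: ge_ereal_sup => _ [e ? <-].
Qed.

Lemma local_dim_le x t C : 0 < C -> has_local_dim mu x ->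
  (forall e, 0 < e < 1 -> C * e `^ t <= mass x e) ->
  (local_dim mu x <= t%:E)%E.
Proof.
move=> C0 hx h; apply/lee_addgt0Pr => eta eta0.
apply: lime_le hx _; exact: near_log_ratio_le h.
Qed.

Lemma cvg_log_ratio x t C1 C2 : 0 < C1 -> 0 < C2 ->
  (forall e, 0 < e < 1 -> C1 * e `^ t <= mass x e <= C2 * e `^ t) ->
  log_ratio mu x e @[e --> 0^'+] --> t%:E.
Proof.
move=> C10 C20 h.
have cvgt C : (t + ln C / ln e)%:E @[e --> 0^'+] --> t%:E.
  by apply: cvg_EFin; [exact: nearW|exact: cvg_add_div_ln].
apply: squeeze_cvge (cvgt C2) (cvgt C1).
apply: filterS near0_lt1 => e e01; have /andP[le1 le2] := h e e01.
rewrite log_ratio_le// log_ratio_ge// (lt_le_trans _ le1)// mulr_gt0// powR_gt0//.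
by have /andP[] := e01.
Qed.

End ball_mass.

(** * Ball masses under a self-similar measure *)

Section self_similar.
Variables (R : realType) (m : nat) (rho : R) (d p : nat -> R).
Variable mu : probability (measurableTypeR R) R.
Hypothesis hrho : 0 < rho < 1.
Hypothesis hd : forall j, (j <= m)%N -> 0 <= d j <= 1 - rho.
Hypothesis hp_pos : forall j, (j <= m)%N -> 0 < p j.
Hypothesis hp_sum : \sum_(j < m.+1) p j = 1.
Hypothesis hmu : self_similar_measure m rho d p mu.
Implicit Types x y e : R.

Let rho0 : 0 < rho. Proof. by have /andP[] := hrho. Qed.

Lemma preimage_ifs_map_itv j x e :
  ifs_map rho d j @^-1` [set` `[x - e, x + e]%R] =
  [set` `[(x - d j) / rho - e / rho, (x - d j) / rho + e / rho]%R].
Proof.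
apply/seteqP; split => z /=; rewrite !in_itv /= /ifs_map -mulrBl -mulrDl.
  move=> /andP[? ?]; rewrite ler_pdivrMr// ler_pdivlMr//; apply/andP; split; lra.
rewrite ler_pdivrMr// ler_pdivlMr// => /andP[? ?]; apply/andP; split; lra.
Qed.

Lemma mass_self_similar x e :
  mass mu x e = \sum_(j < m.+1) p j * mass mu ((x - d j) / rho) (e / rho).
Proof.
apply: EFin_inj; rewrite -measure_itv_mass hmu; last exact: measurable_itv.
rewrite -sumEFin; apply: eq_bigr => j _.
by rewrite preimage_ifs_map_itv measure_itv_mass EFinM.
Qed.

Lemma mass_ge_digit j x e : (j <= m)%N ->
  p j * mass mu ((x - d j) / rho) (e / rho) <= mass mu x e.
Proof.
rewrite -ltnS => jm; rewrite [leRHS]mass_self_similar (bigD1 (Ordinal jm))//= lerDl.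
apply: sumr_ge0 => i _; rewrite mulr_ge0 ?mass_ge0// ltW// hp_pos// -ltnS.
exact: ltn_ord.
Qed.

(** Because [0 <= d j <= 1 - rho], the preimage of [-e, 1 + e] under each map contains
    [-e / rho, 1 + e / rho]. Averaging over [j], the mass at [e] is at least the mass at [e / rho],
    and large intervals have mass close to 1. *)
Lemma mass_unit_enlarged (e : R) : 0 < e -> mass mu (2^-1) (2^-1 + e) = 1.
Proof.
move=> e0; apply/eqP; rewrite eq_le mass_le1 /=; apply/ler_addgt0Pr => eta eta0.
have [N N0 hN] : exists2 N : R, 0 < N & 1 - eta <= mass mu (2^-1) (2^-1 + N).
  pose F n := [set` `[2^-1 - (2^-1 + n.+1%:R), 2^-1 + (2^-1 + n.+1%:R)]%R] :
    set (measurableTypeR R).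
  have cF : mu (F n) @[n --> \oo] --> 1%E.
    rewrite -(probability_setT mu).
    have <- : \bigcup_n F n = setT.
      apply/seteqP; split => // z _; exists (Num.truncn `|z|) => //=.
      have := truncnS_gt `|z|; set u := _%:R => zu.
      have := ler_norm z; have := ler_norm (- z); rewrite normrN => ? ?.
      rewrite /F /= in_itv /=; apply/andP; split; lra.
    apply: nondecreasing_cvg_mu.
    - move=> n; exact: measurable_itv.
    - apply: bigcup_measurable => n _; exact: measurable_itv.
    - move=> n k nk; apply/subsetPset => z; rewrite /F /= !in_itv /=.
      have : n.+1%:R <= k.+1%:R :> R by rewrite ler_nat ltnS.
      move=> ? /andP[? ?]; apply/andP; split; lra.
  have /fine_cvg/cvgrPdist_le/(_ eta eta0)[k _ /(_ k (leqnn k))] /= := cF.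
  rewrite ler_distl => /andP[_ ?]; exists (k.+1%:R) => //.
  rewrite /mass; lra.
(* Measuring [e] in units of [N] makes the base case of [scale_ind] the interval already known to
   have mass at least [1 - eta]. *)
rewrite -lerBlDr -(divfK (lt0r_neq0 N0) e).
have : 0 < e / N by rewrite divr_gt0.
move: (e / N); apply: (scale_ind hrho) => e'.
  move=> e'1; apply: le_trans hN _; apply: le_mass; nra.
move=> _ h; apply: le_trans h _; rewrite [leRHS]mass_self_similar.
rewrite -[leLHS]mul1r -[X in X * _]hp_sum mulr_suml; apply: ler_sum => j _.
have jm : (j <= m)%N by rewrite -ltnS.
rewrite ler_wpM2l ?(ltW (hp_pos jm))//.
have /andP[? ?] := hd jm; have /andP[_ ?] := hrho.
have : e' / rho * N * rho = e' * N by rewrite mulrAC divfK ?lt0r_neq0.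
move: (e' / rho * N) (e' * N) => u v uv.
by apply: le_mass; rewrite -?mulrBl -?mulrDl ?ler_pdivrMr// ?ler_pdivlMr//; lra.
Qed.

Lemma mass_full x e : x - e < 0 -> 1 < x + e -> mass mu x e = 1.
Proof.
move=> h1 h2; apply/eqP; rewrite eq_le mass_le1 /=.
pose eta := Num.min (e - x) (x + e - 1).
have eta0 : 0 < eta by rewrite lt_min; apply/andP; split; lra.
have le1 : eta <= e - x by rewrite ge_min lexx.
have le2 : eta <= x + e - 1 by rewrite ge_min lexx orbT.
rewrite -(mass_unit_enlarged eta0); apply: le_mass; lra.
Qed.

Lemma mass_null x e : (x + e < 0) || (1 < x - e) -> mass mu x e = 0.
Proof.
move=> h.
(* Strictness leaves a margin [eta]: the ball still misses [-eta, 1 + eta], which has full mass. *)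
have [eta eta0 heta] : exists2 eta : R, 0 < eta & (x + e < - eta) || (1 + eta < x - e).
  move/orP: h => [h|h]; [exists (- (x + e) / 2)|exists ((x - e - 1) / 2)];
    try lra; by apply/orP; [left|right]; lra.
apply/eqP; rewrite eq_le mass_ge0 andbT -lee_fin -measure_itv_mass.
pose B := [set` `[2^-1 - (2^-1 + eta), 2^-1 + (2^-1 + eta)]%R] : set (measurableTypeR R).
have mB : measurable B by exact: measurable_itv.
apply: (@le_trans _ _ (mu (~` B))); last first.
  by rewrite probability_setC// measure_itv_mass mass_unit_enlarged// subee.
apply: le_measure; rewrite ?inE; [exact: measurable_itv|exact: measurableC|].
move=> z /=; rewrite /B /= !in_itv /= => /andP[? ?] /andP[].
by case/orP: heta => ? ? ?; lra.
Qed.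

(* The hypothesis on [d j0] says that [x0] is the fixed point of the map of
   index [j0]. *)
Lemma mass_fixed_ge (x0 D : R) j0 : (j0 <= m)%N -> d j0 = (1 - rho) * x0 ->
  0 <= x0 <= 1 -> 0 <= D -> rho `^ D = p j0 ->
  forall e, 0 < e < 1 -> (rho / 2) `^ D * e `^ D <= mass mu x0 e.
Proof.
move=> jm dj0 /andP[x00 x01] D0 pD.
have fixE : (x0 - d j0) / rho = x0.
  by rewrite dj0; field; rewrite gt_eqF.
have /andP[_ rho1] := hrho.
(* The radius [2 * e] makes the ball strictly contain [0, 1] once [e >= 1]; the range [rho * e < 1]
   is preserved by a zoom from [e < 1]. *)
suff key e : 0 < e -> rho * e < 1 -> (rho * e) `^ D <= mass mu x0 (2 * e).
  move=> e /andP[e0 e1]; rewrite -powRM ?divr_ge0 ?(ltW e0) ?(ltW rho0)//.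
  have -> : rho / 2 * e = rho * (e / 2) by ring.
  by rewrite -[in leRHS](divfK (_ : 2 != 0) e)// [in leRHS]mulrC key//; nra.
move: e; apply: (scale_ind hrho) => e.
  move=> e1 re1; rewrite mass_full; [|lra|lra].
  have <- : 1 `^ D = 1 by rewrite powR1.
  have re0 : 0 <= rho * e by rewrite mulr_ge0 ?(ltW rho0)//; lra.
  by apply: ge0_ler_powR; rewrite ?nnegrE// ltW.
move=> /andP[e0 e1] IH _; apply: le_trans (mass_ge_digit _ _ jm).
rewrite fixE -mulrA.
have IH' : (rho * (e / rho)) `^ D <= mass mu x0 (2 * (e / rho)).
  by apply: IH; rewrite mulrCA divff ?mulr1 ?gt_eqF.
apply: le_trans (ler_wpM2l (ltW (hp_pos jm)) IH').
by rewrite [rho * (_ / _)]mulrCA divff ?mulr1 ?gt_eqF// -pD powRM// ltW.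
Qed.

(** At radius [g * e] with [e < 1], the gap keeps the ball away from every piece [d j, d j + rho]
    with [j != j0]. Only one term of the self-similar sum survives, so each zoom costs exactly the
    factor [p j0]. *)
Lemma mass_fixed_le (x0 D g : R) j0 : (j0 <= m)%N -> d j0 = (1 - rho) * x0 ->
  0 <= D -> rho `^ D = p j0 -> 0 < g ->
  (forall j, (j <= m)%N -> j != j0 -> (x0 + g <= d j) || (d j + rho <= x0 - g)) ->
  forall e, 0 < e -> mass mu x0 e <= g^-1 `^ D * e `^ D.
Proof.
move=> jm dj0 D0 pD g0 gap.
have fixE : (x0 - d j0) / rho = x0.
  by rewrite dj0; field; rewrite gt_eqF.
suff key e : 0 < e -> mass mu x0 (g * e) <= e `^ D.
  move=> e e0; rewrite -powRM ?invr_ge0 ?(ltW e0) ?(ltW g0)//.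
  rewrite -[in leLHS](mulVKf (lt0r_neq0 g0) e) key// mulr_gt0// invr_gt0//.
move: e; apply: (scale_ind hrho) => e.
  move=> e1; apply: le_trans (mass_le1 _ _ _) _.
  have <- : 1 `^ D = 1 by rewrite powR1.
  by apply: ge0_ler_powR; rewrite ?nnegrE; lra.
move=> /andP[e0 e1] IH.
have j0m : (j0 < m.+1)%N by [].
rewrite mass_self_similar (bigD1 (Ordinal j0m))//= big1 => [|j jj0].
  rewrite addr0 fixE -mulrA; apply: le_trans (ler_wpM2l (ltW (hp_pos jm)) IH) _.
  rewrite -pD -powRM ?divr_ge0 ?(ltW e0) ?(ltW rho0)//.
  by rewrite mulrCA divff ?mulr1 ?gt_eqF.
rewrite mass_null ?mulr0// -mulrDl -mulrBl pmulr_llt0 ?invr_gt0// ltr_pdivlMr//.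
have jm' : (j <= m)%N by rewrite -ltnS.
have /orP[?|?] := gap j jm' jj0; apply/orP; [left|right]; nra.
Qed.

(* The weights [y `^ s] and [(1 - y) `^ s] make the bound pass through both
   kinds of digits: a forced digit 0 multiplies [y] by [rho^-1], which pays for
   [p 0 < rho `^ t]; any other step uses a digit of probability at least [q] and
   may land on the smallest weight [delta `^ s], since [rho `^ t = q * delta `^ s].
   The conditions on [a] and [b] say that after a forced 0 (resp. m) the digit m
   (resp. 0) is never forced, so that no step switches between the two weights
   without a gain. *)
Lemma mass_interior_ge (a b delta q s t : R) :
  0 < delta -> 0 <= s -> 0 <= t -> 0 <= q ->
  rho `^ t = q * delta `^ s -> rho `^ t * rho `^ s = p 0%N -> p m = p 0%N ->
  d 0%N = 0 -> d m = 1 - rho ->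
  0 < a -> b < 1 -> a <= rho * b -> rho * a + (1 - rho) <= b ->
  (forall y, a <= y <= b -> exists j, [/\ (j <= m)%N, q <= p j &
     delta <= (y - d j) / rho <= 1 - delta]) ->
  forall e, 0 < e -> rho * e < 1 ->
    (forall y, 0 < y <= b -> (rho * e) `^ t * y `^ s <= mass mu y e) /\
    (forall y, a <= y < 1 -> (rho * e) `^ t * (1 - y) `^ s <= mass mu y e).
Proof.
move=> delta0 s0 t0 q0 rhot p0E pmE d0 dm a0 b1 ab ba mid.
have /andP[_ rho1] := hrho.
have b0 : 0 < b by rewrite -(pmulr_rgt0 _ rho0); lra.
have aleb : a <= b by nra.
have powR_le1 (z r : R) : 0 <= r -> 0 <= z -> z <= 1 -> z `^ r <= 1.
  move=> r0 z0 z1; have <- : 1 `^ r = 1 by rewrite powR1.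
  by apply: ge0_ler_powR; rewrite ?nnegrE.
apply: (scale_ind hrho) => e.
  move=> e1 re1; have re0 : 0 <= rho * e by rewrite mulr_ge0 ?(ltW rho0)//; lra.
  split=> y /andP[? ?]; (rewrite mass_full; [|lra|lra]);
    rewrite -[leRHS]mulr1 ler_pM ?powR_ge0// powR_le1//; lra.
move=> /andP[e0 e1] IH re1.
have reK : rho * (e / rho) = e by rewrite mulrCA divff ?mulr1 ?gt_eqF.
have {IH} [IHl IHr] := IH ltac:(by rewrite reK).
rewrite reK in IHl IHr.
have et0 : 0 <= e `^ t by rewrite powR_ge0.
have reE : (rho * e) `^ t = rho `^ t * e `^ t by rewrite powRM// ltW.
have step_mid y v : a <= y <= b -> 0 <= v <= 1 ->
    (rho * e) `^ t * v `^ s <= mass mu y e.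
  move=> aby /andP[v0 v1]; have [j [jm qj /andP[l1 l2]]] := mid y aby.
  apply: le_trans (mass_ge_digit _ _ jm).
  set y' := (y - d j) / rho in l1 l2 *.
  apply: (@le_trans _ _ (p j * (e `^ t * delta `^ s))).
    rewrite reE rhot -mulrA; apply: (@le_trans _ _ (q * (e `^ t * delta `^ s))).
      rewrite -mulrA ler_wpM2l// mulrCA ler_wpM2l// -[leRHS]mulr1.
      by rewrite ler_wpM2l ?powR_ge0// powR_le1.
    by rewrite ler_wpM2r// mulr_ge0// powR_ge0.
  rewrite ler_wpM2l ?(ltW (hp_pos jm))//.
  (* The image lies in [delta, 1 - delta], where both weights are at least that of [delta], so
     whichever inductive bound covers it suffices. *)
  have [y'b|by'] := leP y' b.
    apply: le_trans (IHl y' _); last by rewrite y'b andbT; lra.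
    by rewrite ler_wpM2l//; apply: ge0_ler_powR; rewrite ?nnegrE; lra.
  apply: le_trans (IHr y' _); last by apply/andP; split; lra.
  by rewrite ler_wpM2l//; apply: ge0_ler_powR; rewrite ?nnegrE; lra.
(* A forced end digit loses nothing: the growth of the weight compensates [p 0] exactly. *)
have zoom v : 0 <= v -> p 0%N * (e `^ t * (v / rho) `^ s) = (rho * e) `^ t * v `^ s.
  move=> v0; rewrite -p0E -mulrA [rho `^ s * _]mulrCA -powRM ?divr_ge0 ?(ltW rho0)//.
  by rewrite [rho * (v / rho)]mulrCA divff ?mulr1 ?gt_eqF// reE mulrA.
split=> y /andP[y0 y1].
  have [ay|ya] := leP a y; first by apply: step_mid; apply/andP; split; lra.
  apply: le_trans (mass_ge_digit _ _ (leq0n m)); rewrite d0 subr0.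
  rewrite -(zoom _ (ltW y0)) ler_wpM2l ?(ltW (hp_pos (leq0n m)))//.
  by apply: IHl; rewrite divr_gt0//= ler_pdivrMr//; lra.
have [yb|by_] := leP y b; first by apply: step_mid; apply/andP; split; lra.
apply: le_trans (mass_ge_digit _ _ (leqnn m)).
have y'E : (1 - y) / rho = 1 - (y - d m) / rho.
  by rewrite dm; field; rewrite gt_eqF.
rewrite -zoom; last lra.
rewrite y'E pmE ler_wpM2l ?(ltW (hp_pos (leq0n m)))//.
apply: IHr; rewrite ler_pdivlMr// ltr_pdivrMr// dm; apply/andP; split; lra.
Qed.

(** Pieces trimmed by [rho * delta] at both ends still meet consecutively, as overlaps are at least
    [2 * rho * delta]. Descend from digit [m.-1]: a point left of one trimmed piece is not right of
    the previous one, and the lower bound on [y] stops the descent at digit 1. *)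
Lemma middle_digit (delta : R) : (2 <= m)%N ->
  (forall j, (j < m)%N -> 2 * rho * delta <= d j + rho - d j.+1) ->
  forall y, d 1%N + rho * delta <= y <= d m.-1 + rho - rho * delta ->
  exists j, (0 < j < m)%N /\ delta <= (y - d j) / rho <= 1 - delta.
Proof.
move=> m2 overlap y /andP[y1 y2].
have [k [k0 km yk]] : exists k, [/\ (0 < k)%N, (k < m)%N & y <= d k + rho - rho * delta].
  by exists m.-1; split => //; lia.
elim: k k0 km yk => [//|k IH] _ km yk.
have [dy|yd] := leP (d k.+1 + rho * delta) y.
  exists k.+1; split; first by rewrite km.
  rewrite ler_pdivlMr// ler_pdivrMr//; apply/andP; split; nra.
case: k IH km yk yd => [|k] IH km yk yd; first lra.
apply: IH => //; first exact: ltnW.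
have := overlap k.+1 (ltnW km); lra.
Qed.

End self_similar.

(** Dividing the two equations gives (delta rho)^s = p0 / q, which determines [s], positive because
    [p0 < q]. Then [t >= 0] because q delta^s is at most 1. *)
Lemma exponent_drop (R : realType) (rho delta p0 q : R) :
  0 < rho < 1 -> 0 < delta < 1 -> 0 < p0 < q -> q <= 1 ->
  exists s t : R, [/\ 0 < s, 0 <= t, rho `^ t = q * delta `^ s,
    rho `^ t * rho `^ s = p0 & t + s = ln p0 / ln rho].
Proof.
move=> hrho /andP[delta0 delta1] /andP[p00 p0q] q1.
have /andP[rho0 rho1] := hrho.
have q0 : 0 < q by lra.
have hdr : 0 < delta * rho < 1 by apply/andP; split; nra.
have pq0 : 0 < p0 / q by rewrite divr_gt0.
pose s := ln (p0 / q) / ln (delta * rho).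
pose t := ln p0 / ln rho - s.
have s0 : 0 < s.
  rewrite /s ltr_ndivlMr ?mul0r ?ln_lt0//.
  by rewrite pq0 ltr_pdivrMr// mul1r.
have rhoD : rho `^ (ln p0 / ln rho) = p0 by rewrite powR_log.
have ts : t + s = ln p0 / ln rho by rewrite /t subrK.
have p0E : rho `^ t * rho `^ s = p0.
  by rewrite -powRD ?ts//; apply/implyP => _; rewrite gt_eqF.
have rhot : rho `^ t = q * delta `^ s.
  have rs0 : 0 < rho `^ s by rewrite powR_gt0.
  apply: (mulIf (lt0r_neq0 rs0)); rewrite p0E -mulrA -powRM ?ltW//.
  by rewrite powR_log// mulrCA divff ?mulr1// gt_eqF.
exists s, t; split => //.
have lt0 : ln rho < 0 by apply: ln_lt0.
rewrite -(nmulr_lle0 _ lt0) -ln_powR rhot; apply: ln_le0.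
rewrite mulr_ile1 ?powR_ge0 ?(ltW q0)//.
have <- : 1 `^ s = 1 by rewrite powR1.
by apply: ge0_ler_powR; rewrite ?nnegrE; lra.
Qed.

(** * Dimension [D] at the end points, at most [t < D] inside *)

Unset Implicit Arguments.

Theorem theorem3p4 (R : realType) (m : nat) (rho : R) (d p : nat -> R)
    (mu : probability (measurableTypeR R) R)
    (hm : (2 <= m)%N)
    (hrho : 0 < rho < 1)
    (hd0 : d 0%N = 0)
    (hdm : d m = 1 - rho)
    (hd_lt : forall j : nat, (1 <= j <= m)%N -> d j.-1 < d j)
    (hd_gap : forall j : nat, (1 <= j <= m)%N -> d j - d j.-1 <= rho)
    (hp_pos : forall j : nat, (j <= m)%N -> 0 < p j)
    (hp_sum : \sum_(j < m.+1) p j = 1)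
    (hmu : self_similar_measure m rho d p mu)
    (hoverlap : strict_overlap m rho d)
    (hp_ends : p 0%N = p m)
    (hp_mid : forall j : nat, (0 < j < m)%N -> p m < p j)
    (hright : ifs_map rho d m (ifs_map rho d 1%N 0) < ifs_map rho d m.-1 1)
    (hleft : ifs_map rho d 1%N 0 < ifs_map rho d 0%N (ifs_map rho d m.-1 1)) :
  [/\ has_local_dim mu 0 /\ has_local_dim mu 1,
      local_dim mu 0 \is a fin_num,
      (ereal_sup [set upper_local_dim mu x | x in
         [set x : R | (0 <= x <= 1)%R /\ x <> 0%R /\ x <> 1%R]] < local_dim mu 0)%E,
      local_dim mu 0 = local_dim mu 1
    & isolated (local_dims mu) (local_dim mu 0)].
Proof.
have /andP[rho0 rho1] := hrho.
have m0 : (0 < m)%N by lia.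
have m1m : (0 < m.-1 < m)%N by lia.
have dS j : (j < m)%N -> d j < d j.+1 by move=> jm; apply: (hd_lt j.+1).
have d_mono j k : (j <= k <= m)%N -> d j <= d k.
  elim: k => [|k IH]; first by rewrite leqn0 => /andP[/eqP ->].
  rewrite leq_eqVlt => /andP[/orP[/eqP -> //|jk] km].
  by apply: le_trans (ltW (dS k km)); apply: IH; rewrite -ltnS jk ltnW.
have hd j : (j <= m)%N -> 0 <= d j <= 1 - rho.
  by move=> jm; rewrite -hd0 -hdm !d_mono ?jm ?leqnn.
have d1_gt0 : 0 < d 1%N by rewrite -hd0 dS.
have dm1 : d m.-1 < d m by apply: hd_lt; rewrite m0 leqnn.
have p_le1 j : (j <= m)%N -> p j <= 1.
  rewrite -ltnS => jm; rewrite -hp_sum (bigD1 (Ordinal jm))//= lerDl.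
  by apply: sumr_ge0 => i _; rewrite ltW// hp_pos// -ltnS.
have p0_gt0 := hp_pos 0%N (leq0n m).
have [q [pq q1 qmid]] : exists q, [/\ p 0%N < q, q <= 1 &
    forall j, (0 < j < m)%N -> q <= p j].
  (* [c] is a uniform gain of the middle digits over [p 0]; index 0 gets the harmless value 1. *)
  have [|c c0 hc] := @finite_pos_lower_bound R m
      (fun i => if i == 0%N then 1 else p i - p 0%N).
    case=> [|i] im //=; rewrite subr_gt0 hp_ends; exact: hp_mid.
  have qmid j : (0 < j < m)%N -> p 0%N + c <= p j.
    by case: j => // j /andP[_ jm]; have := hc _ jm => /=; lra.
  exists (p 0%N + c); split => //; first lra.
  by apply: le_trans (p_le1 1%N _); [apply: qmid|]; clear -hm; lia.
have [delta [/andP[delta0 delta1] hov hzero hone]] : exists delta,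
    [/\ 0 < delta < 1, forall j, (j < m)%N -> 2 * rho * delta <= d j + rho - d j.+1,
      d 1%N + rho * delta <= rho * (d m.-1 + rho - rho * delta) &
      rho * (d 1%N + rho * delta) + (1 - rho) <= d m.-1 + rho - rho * delta].
  have [|c c0 hc] := @finite_pos_lower_bound R m (fun j => d j + rho - d j.+1).
    by move=> j jm; have := hoverlap j jm; rewrite /ifs_map; lra.
  have [|g g0 hg] := @finite_pos_lower_bound R 2
      (fun i => if i == 0%N then rho * (rho + d m.-1) - d 1%N
                else rho + d m.-1 - (rho * d 1%N + d m)).
    by move: hleft hright; rewrite /ifs_map hd0 => ? ? [|[|]]//= _; lra.
  have g1 := hg 0%N isT; have g2 := hg 1%N isT; rewrite /= in g1 g2.
  (* [c] bounds the overlaps and [g] the slack in [hleft] and [hright]; each condition loses at most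
     [2 * delta], hence the halves. *)
  pose delta := Num.min 2^-1 (Num.min (c / 2) (g / 2)).
  have : 0 < delta by rewrite /delta !lt_min; apply/and3P; split; lra.
  have : delta <= 2^-1 by rewrite ge_min lexx.
  have : delta <= c / 2 by rewrite !ge_min lexx ?orbT.
  have : delta <= g / 2 by rewrite !ge_min lexx ?orbT.
  move: delta => delta dg dc dh delta0.
  have rd : rho * delta <= delta by nra.
  have rrd : rho * (rho * delta) <= delta by nra.
  exists delta; split; [by apply/andP; split; lra| | |].
  - by move=> j /hc; lra.
  - lra.
  - rewrite hdm in g2; lra.
have [s [t [s0 t0 rhot p0E tsE]]] := @exponent_drop R rho delta (p 0%N) q hrho
  ltac:(by rewrite delta0) ltac:(by rewrite p0_gt0) q1.
set D := ln (p 0%N) / ln rho in tsE.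
have D0 : 0 <= D by lra.
have rhoD : rho `^ D = p 0%N by rewrite powR_log.
have interior x : 0 < x < 1 ->
    exists2 C, 0 < C & forall e, 0 < e < 1 -> C * e `^ t <= mass mu x e.
  move=> /andP[x0 x1].
  set a := d 1%N + rho * delta in hzero hone.
  set b := d m.-1 + rho - rho * delta in hzero hone.
  have rd0 : 0 < rho * delta by rewrite mulr_gt0.
  have a0 : 0 < a by rewrite addr_gt0.
  have b1 : b < 1 by rewrite /b; lra.
  have mid y : a <= y <= b -> exists j, [/\ (j <= m)%N, q <= p j &
      delta <= (y - d j) / rho <= 1 - delta].
    move=> aby; have [|j [jm ?]] := @middle_digit R m rho d hrho delta hm hov y.
      exact: aby.
    exists j; split => //; [by have /andP[_ /ltnW] := jm|exact: qmid].
  have key e : 0 < e < 1 ->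
    (forall y, 0 < y <= b -> (rho * e) `^ t * y `^ s <= mass mu y e) /\
    (forall y, a <= y < 1 -> (rho * e) `^ t * (1 - y) `^ s <= mass mu y e).
    move=> /andP[e0 e1].
    apply: (@mass_interior_ge R m rho d p mu hrho hd hp_pos hp_sum hmu
              a b delta q s t) => //; try lra.
    by nra.
  have powE e v : 0 < e < 1 -> rho `^ t * v `^ s * e `^ t = (rho * e) `^ t * v `^ s.
    by move=> /andP[e0 _]; rewrite powRM ?ltW// mulrAC.
  have [xb|bx] := leP x b.
    exists (rho `^ t * x `^ s); first by rewrite mulr_gt0// powR_gt0.
    by move=> e e01; rewrite powE//; apply: (key e e01).1; rewrite x0.
  exists (rho `^ t * (1 - x) `^ s); first by rewrite mulr_gt0 ?powR_gt0//; lra.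
  move=> e e01; rewrite powE//; apply: (key e e01).2; rewrite x1 andbT.
  have : rho * b <= b by nra.
  lra.
have lower x0 j0 : (j0 <= m)%N -> d j0 = (1 - rho) * x0 -> 0 <= x0 <= 1 ->
    p j0 = p 0%N ->
    forall e, 0 < e < 1 -> (rho / 2) `^ D * e `^ D <= mass mu x0 e.
  move=> j0m dj0 x01 pj0.
  by apply: (@mass_fixed_ge R m rho d p mu hrho hd hp_pos hp_sum hmu x0 D j0) => //;
    rewrite pj0.
have rho2_gt0 : 0 < (rho / 2) `^ D by apply: powR_gt0; rewrite divr_gt0.
have fixed x0 j0 g : (j0 <= m)%N -> d j0 = (1 - rho) * x0 -> 0 <= x0 <= 1 ->
    p j0 = p 0%N -> 0 < g ->
    (forall j, (j <= m)%N -> j != j0 -> (x0 + g <= d j) || (d j + rho <= x0 - g)) ->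
    log_ratio mu x0 e @[e --> 0^'+] --> D%:E.
  move=> j0m dj0 x01 pj0 g0 gap.
  apply: (@cvg_log_ratio R mu x0 D ((rho / 2) `^ D) (g^-1 `^ D)) => //.
    by apply: powR_gt0; rewrite invr_gt0.
  move=> e e01; rewrite (lower x0 j0)//=.
  apply: (@mass_fixed_le R m rho d p mu hrho hd hp_pos hp_sum hmu x0 D g j0) => //.
    by rewrite pj0.
  by have /andP[] := e01.
have cvg0 : log_ratio mu 0 e @[e --> 0^'+] --> D%:E.
  (* All pieces but the first start at or after [d 1]. *)
  apply: (fixed 0 0%N (d 1%N)) => //; rewrite ?hd0 ?mulr0 ?lexx ?ler01//.
  by move=> j jm j0; rewrite add0r d_mono ?jm ?lt0n ?j0.
have cvg1 : log_ratio mu 1 e @[e --> 0^'+] --> D%:E.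
  (* All pieces but the last end by [d m.-1 + rho], which is [1 - (d m - d m.-1)]. *)
  apply: (fixed 1 m (d m - d m.-1)) => //; rewrite ?hdm ?mulr1 ?lexx ?ler01//.
    by rewrite -hdm subr_gt0.
  move=> j jm jnm; apply/orP; right.
  have : d j <= d m.-1 by apply: d_mono; clear -jm jnm m0; lia.
  lra.
have dim0 : local_dim mu 0 = D%:E by apply: (cvg_lim (@ereal_hausdorff R)) cvg0.
have dim1 : local_dim mu 1 = D%:E by apply: (cvg_lim (@ereal_hausdorff R)) cvg1.
have has0 : has_local_dim mu 0 by apply/cvg_ex; exists D%:E.
have has1 : has_local_dim mu 1 by apply/cvg_ex; exists D%:E.
have supp0 : measure_support mu 0.
  (* The radius must be below [e] to fit in the open ball, and below 1 for [lower] to apply. *)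
  move=> e e0; pose r := Num.min e 1 / 2.
  have r0 : 0 < r by rewrite divr_gt0// lt_min e0 ltr01.
  have mine : Num.min e 1 <= e by rewrite ge_min lexx.
  have min1 : Num.min e 1 <= 1 by rewrite ge_min lexx orbT.
  have re : r < e by rewrite /r; lra.
  have r1 : r < 1 by rewrite /r; lra.
  have : 0 < mass mu 0 r.
    apply: lt_le_trans (lower 0 0%N _ _ _ _ r _) => //;
      rewrite ?hd0 ?mulr0 ?lexx ?ler01 ?r0//.
    by rewrite mulr_gt0// powR_gt0.
  rewrite -lte_fin -measure_itv_mass => /lt_le_trans; apply.
  apply: le_measure; rewrite ?inE;
    [exact: measurable_itv|exact: measurable_realfun.measurable_ball|].
  move=> z /=; rewrite in_itv /= /ball /= => /andP[? ?].
  by rewrite sub0r normrN ltr_norml; apply/andP; split; lra.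
have supp01 x : measure_support mu x -> 0 <= x <= 1.
  move=> hx; apply: contrapT => /negP; rewrite negb_and -!ltNge => xout.
  have [r r0 hr] : exists2 r, 0 < r & (x + r < 0) || (1 < x - r).
    case/orP: xout => ?.
      by exists (- x / 2); [lra|apply/orP; left; lra].
    by exists ((x - 1) / 2); [lra|apply/orP; right; lra].
  have : (mu (ball x r) <= (mass mu x r)%:E)%E.
    rewrite -measure_itv_mass.
    apply: le_measure; rewrite ?inE;
      [exact: measurable_realfun.measurable_ball|exact: measurable_itv|].
    move=> z /=; rewrite in_itv /= /ball /= ltr_norml => /andP[? ?].
    by apply/andP; split; lra.
  rewrite (@mass_null R m rho d p mu hrho hd hp_pos hp_sum hmu)// leNgt.
  by move/negP; apply; exact: hx.
have tD : (t%:E < D%:E)%E by rewrite lte_fin; lra.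
split => //.
- by rewrite dim0.
(* The constant [C] depends on [x] but [t] does not, so [t] bounds the whole supremum. *)
- rewrite dim0; apply: le_lt_trans tD; apply: ge_ereal_sup.
  move=> _ [x [/andP[x0 x1] [x0' x1']] <-].
  have [|C C0 hC] := interior x.
    by rewrite !lt_neqAle x0 x1 !andbT eq_sym; apply/andP; split; apply/eqP.
  exact: upper_local_dim_le C0 hC.
- by rewrite dim0 dim1.
- rewrite dim0; split; first by rewrite inE; exists 0.
  (* This neighbourhood of [D] excludes the dimension of every interior point, leaving only the
     common value at 0 and 1. *)
  exists [set u | (t%:E < u)%E]; first exact: open_ereal_gt'.
  apply/seteqP; split=> [u [tu [x [/supp01/andP[x0 x1] hx] ux]]|_ ->]; last first.
    by split => //; exists 0.
  rewrite -{u}ux /= in tu *.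
  have [->//|/eqP x0'] := eqVneq x 0; have [->//|/eqP x1'] := eqVneq x 1.
  have [|C C0 hC] := interior x.
    by rewrite !lt_neqAle x0 x1 !andbT eq_sym; apply/andP; split; apply/eqP.
  by have := lt_le_trans tu (local_dim_le C0 hx hC); rewrite ltxx.
Qed.
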